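(* If $G$ is an irreducible, finitely generated subgroup of $\mathrm{Homeo}^+(\mathbf{R})$, then there exists a homeomorphism $D:\mathbf{R}\to\mathbf{R}$ such that, for every $g\in G$, the map $D\circ g\circ D^{-1}$ is (globally) Lipschitz and has uniformly bounded displacement.
   Context: $\mathrm{Homeo}^+(\mathbf{R})$ is the group of orientation-preserving (increasing) homeomorphisms of the real line. A subgroup $G$ is irreducible if it has no global fixed point, i.e. for every $x\in\mathbf{R}$ there is $g\in G$ with $g(x)\ne x$. A map $h:\mathbf{R}\to\mathbf{R}$ has uniformly bounded displacement if $\sup_{x\in\mathbf{R}}|h(x)-x|<\infty$ (the bound may depend on $h$). *)

(* Defs.v *)
From mathcomp Require Import all_boot all_order all_algebra.
From mathcomp Require Import all_classical all_reals all_analysis.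

Set Implicit Arguments.
Unset Strict Implicit.
Unset Printing Implicit Defensive.

Import Order.TTheory GRing.Theory Num.Theory.
Import numFieldNormedType.Exports.

Local Open Scope classical_set_scope.
Local Open Scope ring_scope.

Definition homeomorphism_with_inverse (X Y : topologicalType)
    (f : X -> Y) (f' : Y -> X) : Prop :=
  [/\ continuous f, continuous f', cancel f f' & cancel f' f].

Definition homeo_plus (R : realType) : set (R -> R) :=
  [set f | (exists f' : R -> R, homeomorphism_with_inverse f f') /\
           {homo f : x y / x < y}].

Definition is_subgroup_homeo_plus (R : realType) (G : set (R -> R)) : Prop :=
  [/\ G `<=` @homeo_plus R,
      G idfun,
      forall f g, G f -> G g -> G (f \o g) &
      forall f f', G f -> cancel f f' -> cancel f' f -> G f'].

(* [smallest] is the intersection of the subgroups containing [S]; the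
   inclusion of [S] in [homeo_plus] ensures that there is at least one. *)
Definition finitely_generated (R : realType) (G : set (R -> R)) : Prop :=
  exists S : set (R -> R),
    [/\ finite_set S, S `<=` @homeo_plus R &
        G = smallest (@is_subgroup_homeo_plus R) S].

Definition irreducible_action (R : realType) (G : set (R -> R)) : Prop :=
  forall x : R, exists2 g : R -> R, G g & g x <> x.

Definition bounded_displacement (R : realType) (h : R -> R) : Prop :=
  (ereal_sup (range (fun x : R => `|h x - x|%:E)) < +oo)%E.

(* Main.v *)
(* Let [A] be a finite symmetric generating list and [T f] the sum of the
   [f \o s], [s \in A], with equal weights of total mass at most [1/2]. Starting
   from a bounded increasing function [u], the series [phi = \sum_n T^n u]
   converges uniformly to a bounded increasing continuous function, and
   [phi = u + T phi] shows that every generator multiplies the increments of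
   [phi] by at most a constant. Thus [phi] conjugates [G] to Lipschitz
   homeomorphisms of a bounded interval ]a, b[. These change the distances to the
   endpoints by bounded factors, so the further change of coordinates
   [t |-> ln (t - a) - ln (b - t)] gives maps of the line with bounded
   displacement, which are still Lipschitz. *)
Require Import Defs.
From mathcomp Require Import all_boot all_order all_algebra.
From mathcomp Require Import all_classical all_reals all_analysis.
From mathcomp Require Import ring lra.
Import Order.TTheory GRing.Theory Num.Theory.
Import numFieldNormedType.Exports.
Local Open Scope classical_set_scope.
Local Open Scope ring_scope.

(** * Weighted averages over a finite list of maps *)

Section HalfAverage.
Context {R : realType}.
Implicit Types (A : seq (R -> R)) (f g : R -> R).

(** The successor keeps the weight positive even for an empty list, while the total mass stays below
    [1/2]. *)
Definition half_avg A f (x : R) : R :=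
  (2 * (size A).+1%:R)^-1 * \sum_(s <- A) f (s x).

Let w_gt0 A : 0 < (2 * (size A).+1%:R)^-1 :> R.
Proof. by rewrite invr_gt0 mulr_gt0. Qed.

Lemma half_avg_ge0 A f : (forall x, 0 <= f x) -> forall x, 0 <= half_avg A f x.
Proof. by move=> f0 x; apply: mulr_ge0; [exact: ltW|exact: sumr_ge0]. Qed.

Lemma half_avg_le A f M : (forall x, 0 <= f x <= M) ->
  forall x, half_avg A f x <= M / 2.
Proof.
move=> fM x; have M0 : 0 <= M by have /andP[/le_trans] := fM 0; apply.
have : \sum_(s <- A) f (s x) <= M *+ (size A).+1.
  rewrite -[leLHS]addr0 mulrSr lerD//.
  elim: A => [|s A IH]; first by rewrite big_nil.
  by rewrite big_cons mulrS lerD// (andP (fM _)).2.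
rewrite -(ler_pM2l (w_gt0 A)) => /le_trans; apply.
rewrite -mulr_natr invfM le_eqVlt; apply/orP; left; apply/eqP.
by field; rewrite -(natrD _ 1) pnatr_eq0.
Qed.

Lemma half_avgB A f g x :
  half_avg A f x - half_avg A g x = half_avg A (fun y => f y - g y) x.
Proof. by rewrite /half_avg -mulrBr sumrB. Qed.

(* Each [s \in A] has weight [(2 * (size A).+1)^-1] in the average, and the
   other increments are nonnegative. *)
Lemma half_avg_increment A f s x y : s \in A ->
  (forall t, t \in A -> f (t x) <= f (t y)) ->
  f (s y) - f (s x) <= 2 * (size A).+1%:R * (half_avg A f y - half_avg A f x).
Proof.
move=> sA fA; rewrite -mulrBr mulrA divff ?gt_eqF ?mulr_gt0// mul1r -sumrB.
rewrite (big_rem s)//= lerDl big_seq sumr_ge0// => t /mem_rem tA.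
by rewrite subr_ge0 fA.
Qed.

Lemma half_avg_homo A f : {homo f : x y / x <= y} ->
  (forall s, s \in A -> {homo s : x y / x <= y}) ->
  {homo half_avg A f : x y / x <= y}.
Proof.
move=> fm Am x y xy; rewrite /half_avg ler_wpM2l ?(ltW (w_gt0 A))//.
rewrite [leLHS]big_seq [leRHS]big_seq; by apply: ler_sum => s sA; apply/fm/Am.
Qed.

Lemma half_avg_continuous A f : continuous f ->
  (forall s, s \in A -> continuous s) -> continuous (half_avg A f).
Proof.
move=> fc Ac x; apply: cvgMl_tmp; rewrite big_seq.
rewrite (_ : (fun y => _) = fun y => \sum_(s <- A | s \in A) f (s y)); last first.
  by apply/funext => y; rewrite big_seq.
apply: cvg_big => [|s sA]; first exact: add_continuous.
by apply: (@continuous_comp _ _ _ s f); [exact: Ac|exact: fc].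
Qed.

End HalfAverage.

(** * The geometric series of the averaging operator *)

Section ControllingFunction.
Context {R : realType}.
Variable A : seq (R -> R).
Hypothesis A_homo : forall s, s \in A -> {homo s : x y / x <= y}.
Hypothesis A_cont : forall s, s \in A -> continuous s.

(** The shift of [atan] makes the seed nonnegative, so that the partial sums increase with [n]. *)
Let seed (x : R) : R := atan x + pi / 2.

Let seed_bound x : 0 <= seed x <= pi.
Proof.
have := atan_gtNpi2 x; have := atan_ltpi2 x; rewrite /seed => h1 h2.
by apply/andP; split; lra.
Qed.

(** Horner form of the sum of [T^k seed] over [k <= n], where [T] is [half_avg A]. *)
Let approx n : R -> R := iter n (fun f x => seed x + half_avg A f x) seed.

Let approxS n x : approx n.+1 x = seed x + half_avg A (approx n) x.
Proof. by []. Qed.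

(** The bound [2 * pi] is the fixed point of [M |-> pi + M / 2]. *)
Let approx_bound n x : 0 <= approx n x <= 2 * pi.
Proof.
have pi0 : 0 <= pi :> R by exact: pi_ge0.
elim: n x => [|n IH] x.
  by have /andP[s0 s1] := seed_bound x; apply/andP; split => //=; lra.
have /andP[s0 s1] := seed_bound x.
have := half_avg_le A _ _ IH x.
have := @half_avg_ge0 _ A (approx n) (fun z => (andP (IH z)).1) x.
by rewrite approxS => h1 h2; apply/andP; split; lra.
Qed.

(** By linearity, raising [n] by one applies [half_avg] to the difference, which halves its upper
    bound. *)
Let approx_tail n m x : 0 <= approx (n + m) x - approx n x <= 2 * pi / 2 ^+ n.
Proof.
elim: n x => [|n IH] x.
  rewrite expr0 divr1 add0n; case: m => [|m].
    by rewrite subrr lexx mulr_ge0// pi_ge0.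
  have /andP[s0 s1] := seed_bound x.
  have := @half_avg_ge0 _ A (approx m) (fun z => (andP (approx_bound m z)).1) x.
  have := approx_bound m.+1 x; rewrite approxS [approx 0 x]/= => /andP[h1 h2] h3.
  by apply/andP; split; lra.
rewrite addSn !approxS opprD addrACA subrr add0r half_avgB.
rewrite half_avg_ge0 ?exprSr ?invfM ?mulrA//=; last first.
  by move=> z; have /andP[] := IH z.
exact: half_avg_le.
Qed.

Let approx_nd x : {homo approx ^~ x : n m / (n <= m)%N >-> n <= m}.
Proof.
move=> n m nm; rewrite -subr_ge0 -(subnKC nm).
by have /andP[] := approx_tail n (m - n) x.
Qed.

Let approx_cvg x : cvgn (approx ^~ x).
Proof.
apply: nondecreasing_is_cvgn => //; exists (2 * pi) => _ [n _ <-].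
by have /andP[] := approx_bound n x.
Qed.

Let limit (x : R) : R := limn (approx ^~ x).

Let limit_bound x : 0 <= limit x <= 2 * pi.
Proof.
rewrite /limit limr_ge ?limr_le//; apply: nearW => n;
  by have /andP[] := approx_bound n x.
Qed.

Let limit_tail n x : 0 <= limit x - approx n x <= 2 * pi / 2 ^+ n.
Proof.
rewrite subr_ge0 lerBlDl; apply/andP; split.
  apply: limr_ge => //; near=> m; apply: approx_nd; near: m.
  exact: nbhs_infty_ge.
apply: limr_le => //; near=> m.
have nm : (n <= m)%N by near: m; exact: nbhs_infty_ge.
by have /andP[_] := approx_tail n (m - n) x; rewrite subnKC// lerBlDl.
Unshelve. all: by end_near. Qed.

Let approx_homo n : {homo approx n : x y / x <= y}.
Proof.
elim: n => [|n IH] x y xy; first by rewrite lerD2r; exact: le_atan.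
by rewrite !approxS lerD ?half_avg_homo// lerD2r; exact: le_atan.
Qed.

Let approx_cont n : continuous (approx n).
Proof.
have sc : continuous seed.
  by move=> x; apply: cvgD; [exact: continuous_atan|exact: cvg_cst].
elim: n => [//|n IH] x; apply: cvgD; first exact: sc.
exact: half_avg_continuous.
Qed.

Let limit_cont : continuous limit.
Proof.
move=> x; apply/cvgrPdist_lt => e e0.
(* An [e / 3] argument: this [n] makes the tail small at all points at once. *)
have [n ne] : exists n, 2 * pi / 2 ^+ n < e / 3.
  have : (fun n => 2 * pi * 2^-1 ^+ n) @ \oo --> (0 : R).
    by apply: cvg_geometric; rewrite ger0_norm// invf_lt1// ltr1n.
  move=> /cvgrPdist_lt/(_ (e / 3)); rewrite divr_gt0// => /(_ isT)[n _ /(_ n)].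
  rewrite /= leqnn sub0r normrN => /(_ isT); rewrite exprVn => h.
  by exists n; exact: le_lt_trans (ler_norm _) h.
have /cvgrPdist_lt/(_ (e / 3)) := approx_cont n x.
rewrite divr_gt0// => /(_ isT); apply: filterS => y.
have := limit_tail n x; have := limit_tail n y.
move=> /andP[h1 h2] /andP[h3 h4]; rewrite !ltr_norml => /andP[h5 h6].
by apply/andP; split; lra.
Qed.

(** The averaged part is nondecreasing, so the increment of [seed] survives in the limit; strict
    monotonicity follows, which a pointwise limit need not inherit. *)
Let limit_increment x y : x <= y ->
  seed y - seed x <= limit y - limit x.
Proof.
move=> xy; rewrite -limB//; apply: limr_ge; first exact: is_cvgB.
near=> n.
have n0 : (0 < n)%N by near: n; exact: nbhs_infty_gt.
rewrite -(prednK n0) !fctE !approxS.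
have := half_avg_homo A _ (approx_homo n.-1) A_homo x y xy; lra.
Unshelve. all: by end_near. Qed.

Lemma exists_controlling_function : exists (phi : R -> R) (n : nat),
  [/\ continuous phi, {homo phi : x y / x < y}, has_lbound (range phi),
      has_ubound (range phi) &
      forall s x y, s \in A -> x <= y ->
        phi (s y) - phi (s x) <= n%:R * (phi y - phi x)].
Proof.
exists limit, (2 * (size A).+1)%N; split => //.
- move=> x y xy; have := limit_increment _ _ (ltW xy).
  by have := lt_atan xy; rewrite /seed; lra.
- by exists 0 => _ [x _ <-]; have /andP[] := limit_bound x.
- by exists (2 * pi) => _ [x _ <-]; have /andP[] := limit_bound x.
move=> s x y sA xy; set C := _%:R.
(* Stage [n] on the left is compared with stage [n.+1] on the right, since [approx n.+1] contains
   the average of [approx n]. *)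
have cvgS z : approx n.+1 z @[n --> \oo] --> limit z.
  by rewrite (cvg_shiftS (approx ^~ z)); exact: approx_cvg.
apply: (ler_cvg_to (cvgB (approx_cvg (s y)) (approx_cvg (s x)))
                   (cvgMl_tmp (a := C) (cvgB (cvgS y) (cvgS x)))).
apply: nearW => n; rewrite !fctE.
have := @half_avg_increment _ A (approx n) s x y sA
  (fun t tA => @approx_homo n _ _ (A_homo t tA _ _ xy)).
move=> /le_trans; apply; rewrite /C natrM ler_wpM2l// !approxS.
by have := le_atan xy; rewrite /seed; lra.
Qed.
End ControllingFunction.

(** * Increasing homeomorphisms of the line *)

Section Homeomorphisms.
Context {R : realType}.

Lemma homeo_plus_inverse (f f' : R -> R) : homeo_plus f ->
  cancel f f' -> cancel f' f -> homeo_plus f'.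
Proof.
move=> [[g [fc gc fK gK] fi]] f_f' f'_f.
have -> : f' = g by apply/funext => x; rewrite -{1}[x]gK f_f'.
split; first by exists f.
move=> x y xy; rewrite ltNge; apply/negP; rewrite le_eqVlt => /orP[/eqP e|].
  by move: xy; rewrite -[x]gK -[y]gK e ltxx.
by move=> /fi; rewrite !gK; apply/negP; rewrite -leNgt ltW.
Qed.

Lemma unbounded_increasing_homeomorphism (D : R -> R) : continuous D ->
  {homo D : x y / x < y} ->
  (forall M, exists x, D x <= M) -> (forall M, exists x, M <= D x) ->
  exists D', homeomorphism_with_inverse D D'.
Proof.
move=> Dc Di Dlow Dhigh.
have Dle x y : x <= y -> D x <= D y.
  by rewrite le_eqVlt => /predU1P[->//|/Di/ltW].
have Dlt x y : D x < D y -> x < y.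
  by move=> xy; rewrite ltNge; apply/negP => /Dle; apply/negP; rewrite -ltNge.
have surj y : exists x, D x = y.
  have [a aM] := Dlow y; have [b bM] := Dhigh y.
  pose c := Num.min a b; pose d := Num.max a b.
  have cM : D c <= y by apply: le_trans aM; apply: Dle; rewrite ge_min lexx.
  have dM : y <= D d.
    by apply: (le_trans bM); apply: Dle; rewrite le_max lexx orbT.
  have cd : c <= d by rewrite le_max !ge_min lexx.
  have [] := @IVT R D c d y cd.
  - exact: continuous_subspaceT.
  - by rewrite ge_min le_max cM dM orbT.
  - by move=> x _ <-; exists x.
have [D' DK] := choice surj.
exists D'; split => //; last first.
  move=> x; have := DK (D x).
  by case: (ltgtP (D' (D x)) x) => // /Di; [move=> /[swap] ->|move=> /[swap] ->];
    rewrite ltxx.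
(* Any [z] close to [y] lies between the values of [D] at [D' y - e] and [D' y + e]. *)
move=> y; apply/cvgrPdist_lt => e e0; near=> z.
have h1 : D' y - e < D' z.
  apply: Dlt; rewrite DK; near: z; apply: lt_nbhsr.
  by rewrite -{2}[y]DK; apply: Di; rewrite gtrBl.
have h2 : D' z < D' y + e.
  apply: Dlt; rewrite DK; near: z; apply: lt_nbhsl.
  by rewrite -{1}[y]DK; apply: Di; rewrite ltrDl.
by rewrite ltr_norml; apply/andP; split; lra.
Unshelve. all: by end_near. Qed.
End Homeomorphisms.

(** * The logarithm of the distance to an endpoint *)

Section LogarithmicCoordinate.
Context {R : realType}.
Implicit Types (phi f : R -> R) (n : nat).

(* Phrased through the order of the values of [phi], so as to be invariant
   under [phi |-> - phi]. *)
Definition controls phi f n := forall x y, phi x <= phi y ->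
  0 <= phi (f y) - phi (f x) <= n%:R * (phi y - phi x).

Lemma controlsN phi f n : controls phi f n -> controls (\- phi) f n.
Proof.
move=> H x y; rewrite lerN2 => /H; rewrite !opprK.
by rewrite [_ - phi (f y)]addrC [_ - phi y]addrC.
Qed.

Lemma controls_id phi : controls phi idfun 1.
Proof. by move=> x y xy; rewrite mul1r subr_ge0 xy /=. Qed.

Lemma controls_comp phi f g n m : controls phi f n -> controls phi g m ->
  controls phi (f \o g) (n * m).
Proof.
move=> fn gm x y xy; have /andP[h1 h2] := gm _ _ xy.
have := fn (g x) (g y); rewrite -subr_ge0 => /(_ h1)/andP[h3 h4].
by rewrite h3 (le_trans h4)// natrM -mulrA ler_wpM2l.
Qed.

(** Bernoulli's inequality: [b' / a' <= 1 + n^2 * (b - a) / a <= (b / a)^(n^2)]. One factor [n]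
    comes from the increments, the other from [a <= n * a']. *)
Lemma ln_increment_le n (a b a' b' : R) : 0 < a -> a <= b ->
  0 < a' -> a' <= b' -> b' - a' <= n%:R * (b - a) -> a <= n%:R * a' ->
  ln b' - ln a' <= (n ^ 2)%:R * (ln b - ln a).
Proof.
move=> a0 ab a'0 a'b' inc aa'.
have b0 : 0 < b by exact: lt_le_trans ab.
have b'0 : 0 < b' by exact: lt_le_trans a'b'.
rewrite -!ln_div ?posrE// mulr_natl -lnXn ?divr_gt0//.
rewrite ler_ln ?posrE ?exprn_gt0 ?divr_gt0//.
have bernoulli (m : nat) (t : R) : 0 <= t -> 1 + m%:R * t <= (1 + t) ^+ m.
  move=> t0; elim: m => [|m IH]; first by rewrite mul0r addr0 expr0.
  rewrite exprSr; apply: (@le_trans _ _ ((1 + m%:R * t) * (1 + t))).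
    by rewrite -natr1; have : 0 <= m%:R :> R by []; nra.
  by rewrite ler_wpM2r// addr_ge0.
have t0 : 0 <= (b - a) / a by rewrite divr_ge0 ?subr_ge0// ltW.
have -> : b / a = 1 + (b - a) / a by field; rewrite gt_eqF.
apply: le_trans (bernoulli _ _ t0).
rewrite -subr_ge0.
have -> : b' / a' = 1 + (b' - a') / a' by field; rewrite gt_eqF.
rewrite subr_ge0 lerD2l ler_pdivrMr//; apply: (le_trans inc).
have -> : (n ^ 2)%:R * ((b - a) / a) * a' = n%:R * ((b - a) / a) * (n%:R * a') :> R.
  by rewrite natrX; ring.
apply: le_trans (_ : n%:R * ((b - a) / a) * a <= _).
  by rewrite -mulrA divfK// gt_eqF.
by rewrite ler_wpM2l// mulr_ge0.
Qed.

(** For [- phi] this is the logarithm of the distance from [phi x] to the supremum of [phi], so one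
    definition serves both endpoints. *)
Definition log_height phi x := ln (phi x - inf (range phi)).

Section Height.
Variable phi : R -> R.
Hypothesis phi_lb : has_lbound (range phi).
Hypothesis inf_lt_phi : forall x, inf (range phi) < phi x.

Let height_gt0 x : 0 < phi x - inf (range phi).
Proof. by rewrite subr_gt0. Qed.

Lemma log_height_le x y : (log_height phi x <= log_height phi y) = (phi x <= phi y).
Proof. by rewrite ler_ln ?posrE// lerD2r. Qed.

(** The condition [phi x <= phi 0] serves to bound the coordinate at the other endpoint along the
    same points. *)
Lemma log_height_unbounded M : exists x, log_height phi x <= M /\ phi x <= phi 0.
Proof.
have : has_inf (range phi) by split => //; exists (phi 0); exists 0.
move=> /(inf_adherent (expR_gt0 M))[_ [x _ <-]]; rewrite -ltrBlDl => xM.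
have xM' : log_height phi x <= M.
  by rewrite -[M]expRK ler_ln ?posrE ?expR_gt0// ltW.
have [x0|/ltW x0] := leP (phi x) (phi 0); first by exists x.
by exists 0; split => //; rewrite (le_trans _ xM')// log_height_le.
Qed.

Lemma log_height_continuous : continuous phi -> continuous (log_height phi).
Proof.
move=> phic x; rewrite /log_height; apply: continuous_cvg.
  exact: continuous_ln.
by apply: cvgB; [exact: phic|exact: cvg_cst].
Qed.

(* Let [phi (f w)] tend to the infimum. *)
Lemma height_le f f' n : cancel f' f -> controls phi f n -> forall x,
  phi (f x) - inf (range phi) <= n%:R * (phi x - inf (range phi)).
Proof.
move=> f'K fn x; rewrite lerBlDr -lerBlDl.
apply: lb_le_inf; first by exists (phi 0), 0.
move=> _ [z _ <-]; rewrite -[z]f'K; set w := f' z.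
have bnd : 0 <= n%:R * (phi x - inf (range phi)) by rewrite mulr_ge0// ltW.
(* Below [x] the increment from [w] to [x] is controlled; above [x], already
   [phi (f x) <= phi (f w)]. *)
have [wx|/ltW xw] := leP (phi w) (phi x).
  have /andP[_] := fn _ _ wx.
  have : n%:R * (phi x - phi w) <= n%:R * (phi x - inf (range phi)).
    by rewrite ler_wpM2l// lerB// ltW.
  lra.
have /andP[] := fn _ _ xw; lra.
Qed.

Variables (f f' : R -> R) (n : nat).
Hypotheses (fK : cancel f f') (f'K : cancel f' f).
Hypotheses (fn : controls phi f n) (f'n : controls phi f' n).

(** Control of the inverse gives the lower bound on the height of [f x] that [ln_increment_le]
    requires. *)
Lemma log_height_increment x y : phi x <= phi y ->
  0 <= log_height phi (f y) - log_height phi (f x)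
    <= (n ^ 2)%:R * (log_height phi y - log_height phi x).
Proof.
move=> xy; have /andP[h1 h2] := fn _ _ xy.
rewrite subr_ge0 log_height_le -subr_ge0 h1/=.
apply: ln_increment_le => //; rewrite ?lerD2r//.
- by rewrite -subr_ge0.
- by move: h2; lra.
- by rewrite -{1}[x]fK; exact: height_le fK f'n _.
Qed.

(** Both [f] and its inverse multiply heights by at most [n]. *)
Lemma log_height_displacement x : `|log_height phi (f x) - log_height phi x| <= ln n%:R.
Proof.
have n0 : 0 < n%:R :> R.
  rewrite ltr0n lt0n; apply/eqP => n0; have := height_le _ _ _ f'K fn x.
  by rewrite n0 mul0r leNgt height_gt0.
have H z : 0 < n%:R * (phi z - inf (range phi)) by rewrite mulr_gt0.
have h1 : log_height phi (f x) <= ln n%:R + log_height phi x.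
  by rewrite -lnM ?posrE// ler_ln ?posrE//; exact: height_le f'K fn x.
have h2 : log_height phi x <= ln n%:R + log_height phi (f x).
  by rewrite -lnM ?posrE// ler_ln ?posrE// -{1}[x]fK; exact: height_le fK f'n _.
by rewrite ler_norml; apply/andP; split; lra.
Qed.

End Height.
End LogarithmicCoordinate.

(** * From controlled generators to a controlled group *)

Section ControlledGroup.
Context {R : realType}.
Implicit Types (phi f : R -> R) (n : nat).

Lemma homeo_plus_id : homeo_plus (@idfun R).
Proof.
split; last by [].
by exists idfun; split => // x; exact: cvg_id.
Qed.

Lemma homeo_plus_comp f g : homeo_plus f -> homeo_plus g -> homeo_plus (f \o g).
Proof.
move=> [[f' [fc f'c fK f'K]] fi] [[g' [gc g'c gK g'K]] gi]; split.
  exists (g' \o f'); split; [| |exact: can_comp|exact: can_comp] => x.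
    by apply: continuous_comp; [exact: gc|exact: fc].
  by apply: continuous_comp; [exact: f'c|exact: g'c].
by move=> x y /gi/fi.
Qed.

Lemma homeo_plus_homo f : homeo_plus f -> {homo f : x y / x <= y}.
Proof.
by move=> [_ fi] x y; rewrite le_eqVlt => /predU1P[->//|/fi/ltW].
Qed.

(** The constant may depend on [f]; controlling the inverse as well makes this set a subgroup. *)
Definition bicontrolled phi : set (R -> R) := [set f | homeo_plus f /\
  exists f' n, [/\ cancel f f', cancel f' f, controls phi f n & controls phi f' n]].

Lemma bicontrolled_subgroup phi : is_subgroup_homeo_plus (bicontrolled phi).
Proof.
split.
- by move=> f [].
- split; first exact: homeo_plus_id.
  by exists idfun, 1%N; split => //; exact: controls_id.
- move=> f g [hf [f' [n [fK f'K fn f'n]]]] [hg [g' [m [gK g'K gm g'm]]]].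
  split; first exact: homeo_plus_comp.
  exists (g' \o f'), (n * m)%N; split; [exact: can_comp|exact: can_comp| |].
    exact: controls_comp.
  by rewrite mulnC; exact: controls_comp.
- move=> f f' [hf [f1 [n [fK f1K fn f1n]]]] ff' f'f.
  split; first exact: homeo_plus_inverse f'f.
  exists f, n; split => //.
  by rewrite (_ : f' = f1)//; apply/funext => x; rewrite -{1}[x]f1K ff'.
Qed.

(** By minimality of the generated subgroup, only the generators need to be controlled. *)
Lemma finitely_generated_controlled (G : set (R -> R)) : finitely_generated G ->
  exists phi, [/\ continuous phi, {homo phi : x y / x < y},
    has_lbound (range phi), has_ubound (range phi) & G `<=` bicontrolled phi].
Proof.
move=> [S [/finite_seqP[gens ->] S_homeo ->]].
have inv_ex (s : R -> R) :
    exists s', s \in gens -> cancel s s' /\ cancel s' s.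
  (* The identity is a dummy value off the generators, so that choice yields a total function. *)
  have [sg|_] := boolP (s \in gens); last by exists idfun.
  by have [[s' [_ _ sK s'K]] _] := S_homeo s sg; exists s'.
have [inv invP] := choice inv_ex.
have inv_homeo s : s \in gens -> homeo_plus (inv s).
  by move=> sg; have [] := invP s sg; apply: homeo_plus_inverse; exact: S_homeo.
pose A := gens ++ map inv gens.
have A_homeo s : s \in A -> homeo_plus s.
  rewrite mem_cat => /orP[/S_homeo//|/mapP[t tg ->]]; exact: inv_homeo.
have [||phi [n [phic phii phil phiu phin]]] := @exists_controlling_function R A.
- by move=> s /A_homeo/homeo_plus_homo.
- by move=> s /A_homeo[[? []]].
exists phi; split => //.
have phi_mono x y : (phi x <= phi y) = (x <= y).
  by apply: (@le_mono _ _ _ _ phi).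
have A_controls s : s \in A -> controls phi s n.
  move=> sA x y; rewrite phi_mono => xy.
  by rewrite phin// subr_ge0 phi_mono (homeo_plus_homo _ (A_homeo s sA)).
apply: smallest_sub; first exact: bicontrolled_subgroup.
move=> s sg; split; first exact: S_homeo.
have [sK s'K] := invP s sg.
exists (inv s), n; split => //; apply: A_controls; rewrite mem_cat ?sg//.
by rewrite map_f ?orbT.
Qed.

End ControlledGroup.

(** * The conjugating homeomorphism *)

Theorem theorem8p5 (R : realType) (G : set (R -> R))
    (G_subgroup : is_subgroup_homeo_plus G)
    (G_irreducible : irreducible_action G)
    (G_fin_gen : finitely_generated G) :
  exists D D' : R -> R,
    homeomorphism_with_inverse D D' /\
    forall g : R -> R, G g ->
      lipschitz (D \o g \o D') /\ bounded_displacement (D \o g \o D').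
Proof.
have [phi [phic phii phil phiu Gphi]] := finitely_generated_controlled G G_fin_gen.
pose psi : R -> R := \- phi.
have psil : has_lbound (range psi).
  have [M phiM] := phiu; exists (- M) => _ [x _ <-].
  by rewrite lerN2; apply: phiM; exists x.
have psic : continuous psi by move=> x; apply: cvgN; exact: phic.
(* A strictly increasing function on the line does not attain its infimum. *)
have phi_inf x : inf (range phi) < phi x.
  apply: le_lt_trans (phii (x - 1) x _); last by rewrite gtrBl.
  by apply: ge_inf => //; exists (x - 1).
have psi_inf x : inf (range psi) < psi x.
  apply: (@le_lt_trans _ _ (psi (x + 1))); last by rewrite ltrN2 phii// ltrDl.
  by apply: ge_inf => //; exists (x + 1).
pose P := log_height phi; pose Q := log_height psi.
(* With [a], [b] the infimum and supremum of [phi], this is [ln ((phi x - a) / (b - phi x))]. *)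
pose D x := P x - Q x.
have P_le x y : (P x <= P y) = (phi x <= phi y) by exact: log_height_le.
have Q_le x y : (Q x <= Q y) = (phi y <= phi x).
  by rewrite /Q log_height_le// lerN2.
have [D' DD'] : exists D' : R -> R, homeomorphism_with_inverse D D'.
  apply: unbounded_increasing_homeomorphism.
  - by move=> x; apply: cvgB; exact: log_height_continuous.
  - move=> x y /phii xy; rewrite ltr_leB// ?Q_le ?(ltW xy)//.
    by rewrite ltNge P_le -ltNge.
  (* Left of [0] one has [Q 0 <= Q x], so [D x <= P x - Q 0]. *)
  - move=> M; have [x [xM x0]] := log_height_unbounded phi phil phi_inf (M + Q 0).
    by exists x; rewrite lerBlDr (le_trans xM)// lerD2l Q_le.
  - move=> M; have [x [xM x0]] := log_height_unbounded psi psil psi_inf (P 0 - M).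
    exists x; rewrite lerBrDl -lerBrDr (le_trans xM)// lerB// P_le.
    by move: x0; rewrite lerN2.
exists D, D'; split => // f /Gphi[_ [f' [n [fK f'K fn f'n]]]].
have [_ _ DK D'K] := DD'.
have pn := controlsN _ _ _ fn; have p'n := controlsN _ _ _ f'n.
(* [P] increases and [Q] decreases, so their increments add up in [D], each stretched by at most
   [n ^ 2]. *)
have D_increment x y : phi x <= phi y ->
    0 <= D (f y) - D (f x) <= (n ^ 2)%:R * (D y - D x).
  move=> xy; have yx : psi y <= psi x by rewrite lerN2.
  have /andP[] := log_height_increment phi phi_inf f f' n fK fn f'n x y xy.
  have /andP[] := log_height_increment psi psi_inf f f' n fK pn p'n y x yx.
  rewrite -/P -/Q /D => h1 h2 h3 h4; apply/andP; split; lra.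
split.
- have ? : ProperFilter (globally ([set: R] `*` [set: R])).
    exact: (@globally_properfilter _ _ (0, 0)).
  apply: (@klipschitzW _ _ _ (n ^ 2)%:R) => -[u v] _ /=.
  wlog uv : u v / phi (D' u) <= phi (D' v).
    move=> H; have [|/ltW] := leP (phi (D' u)) (phi (D' v)); first exact: H.
    by move=> /H; rewrite distrC [`|v - u|]distrC.
  have /andP[h1 h2] := D_increment _ _ uv.
  rewrite distrC [`|u - v|]distrC ger0_norm//.
  by rewrite (le_trans h2)// ler_wpM2l// !D'K ler_norm.
- apply: (@le_lt_trans _ _ (ln n%:R + ln n%:R)%:E); last exact: ltry.
  apply: ge_ereal_sup => _ [u _ <-]; rewrite lee_fin /=.
  rewrite -{2}[u]D'K; set x := D' u.
  have h1 := log_height_displacement phi phi_inf f f' n fK f'K fn f'n x.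
  have h2 := log_height_displacement psi psi_inf f f' n fK f'K pn p'n x.
  (* The two endpoint coordinates each contribute at most [ln n]. *)
  rewrite (_ : D (f x) - D x = P (f x) - P x - (Q (f x) - Q x)).
    by rewrite (le_trans (ler_normB _ _))// lerD.
  by rewrite /D; ring.
Qed.
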